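(* Let $Y$, $x$, $T$ be as in the context, and let $W$ be an irreducible $T$-module with endpoint $r$, dual endpoint $t$ and diameter $d$. If $d=0$ then $c_0(W)=0$, $a_0(W)=\theta_t$, $b_0(W)=0$. If $d\ge1$ then $c_0(W)=0$, $c_i(W)=\dfrac{\theta_t(\theta^*_{r+i+1}-\theta^*_{r+1})-\theta_{t+1}(\theta^*_{r+i}-\theta^*_r)}{\theta^*_{r+i+1}-\theta^*_{r+i-1}}$ for $1\le i\le d-1$, $c_d(W)=\dfrac{\theta_t(\theta^*_{r+d}-\theta^*_{r+1})-\theta_{t+1}(\theta^*_{r+d}-\theta^*_r)}{\theta^*_{r+d}-\theta^*_{r+d-1}}$, $a_i(W)=0$ for $0\le i\le d-1$, $a_d(W)=\dfrac{\theta_t(\theta^*_{r+d-1}-\theta^*_{r+1})-\theta_{t+1}(\theta^*_{r+d}-\theta^*_r)}{\theta^*_{r+d-1}-\theta^*_{r+d}}$, $b_0(W)=\theta_t$, $b_i(W)=\dfrac{\theta_t(\theta^*_{r+i-1}-\theta^*_{r+1})-\theta_{t+1}(\theta^*_{r+i}-\theta^*_r)}{\theta^*_{r+i-1}-\theta^*_{r+i+1}}$ for $1\le i\le d-1$, $b_d(W)=0$. In particular $c_i(W),a_i(W),b_i(W)$ are real for $0\le i\le d$.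
   Context: $Y=(X,\{R_i\}_{0\le i\le D})$ is a symmetric association scheme ($X$ finite; $R_i$ partition $X\times X$, $R_0$ diagonal, $R_i$ symmetric; $p^h_{ij}=|\{z:(x,z)\in R_i,(z,y)\in R_j\}|$ for $(x,y)\in R_h$ independent of $x,y$), with $D\ge3$, associate matrices $A_i$ ($(A_i)_{xy}=1$ iff $(x,y)\in R_i$), Bose–Mesner algebra $M=\mathrm{span}\{A_i\}$ with primitive idempotents $E_0,\dots,E_D$ ($E_iE_j=\delta_{ij}E_i$, $\sum E_i=I$, $E_0=|X|^{-1}J$), and Krein parameters $q^h_{ij}$ ($E_i\circ E_j=|X|^{-1}\sum_hq^h_{ij}E_h$). $Y$ is P-polynomial w.r.t. $R_0,\dots,R_D$ ($p^h_{ij}=0$ if one of $h,i,j$ exceeds the sum of the other two, $\ne0$ if it equals that sum), almost-bipartite ($p^i_{1i}=0$ for $0\le i\le D-1$, $p^D_{1D}\ne0$), and Q-polynomial w.r.t. $E_0,\dots,E_D$ (same conditions for $q^h_{ij}$). $A=A_1$ and $\theta_i$ is defined by $AE_i=\theta_iE_i$. Fix $x\in X$: $E^*_i$ is diagonal with $(E^*_i)_{yy}=1$ iff $(x,y)\in R_i$; $A^*$ is diagonal with $(A^* )_{yy}=|X|(E_1)_{xy}$; $\theta^*_i$ is defined by $A^*E^*_i=\theta^*_iE^*_i$. Set $E^*_i=0$ for $i\notin[0,D]$. $T=T(x)$ is generated by $M$ and $\mathrm{span}\{E^*_i\}$. $R=\sum_iE^*_{i+1}AE^*_i$, $F=\sum_iE^*_iAE^*_i$,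 $L=\sum_iE^*_{i-1}AE^*_i$. For an irreducible $T$-module $W\subseteq\mathbb{C}^X$: endpoint $r=\min\{i:E^*_iW\neq0\}$, dual endpoint $t=\min\{i:E_iW\ne0\}$, diameter $d=|\{i:E^*_iW\ne0\}|-1$. In this setting every irreducible $W$ is thin ($\dim E^*_iW\le1$) and dual thin ($\dim E_iW\le1$); the intersection numbers $c_i(W),a_i(W),b_i(W)$ ($0\le i\le d$) are the scalars with $RE^*_{r+i-1}v=c_i(W)E^*_{r+i}v$, $FE^*_{r+i}v=a_i(W)E^*_{r+i}v$, $LE^*_{r+i+1}v=b_i(W)E^*_{r+i}v$ for any nonzero $v\in E_tW$ (independent of $v$). *)

(* Defs.v *)
From HB Require Import structures.
From mathcomp Require Import all_boot all_order all_algebra.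
From mathcomp Require Import mathcomp_extra boolp classical_sets reals.
From mathcomp Require Import complex.

Set Implicit Arguments.
Unset Strict Implicit.
Unset Printing Implicit Defensive.

Import Order.TTheory GRing.Theory Num.Theory.

Local Open Scope ring_scope.

(* Families indexed by 0, ..., D are functions on nat whose values beyond D
   are left unconstrained. *)

Record assoc_scheme (X : finType) (D : nat) := AssocScheme {
  srel :> nat -> rel X;
  (* [inum h i j] is p^h_{ij} *)
  inum : nat -> nat -> nat -> nat;
  srel_nonempty : forall i, (i <= D)%N -> exists x y, srel i x y;
  srel_cover : forall x y, exists2 i, (i <= D)%N & srel i x y;
  srel_disjoint : forall i j x y, (i <= D)%N -> (j <= D)%N ->
    srel i x y -> srel j x y -> i = j;
  srel0 : forall x y, srel 0%N x y = (x == y);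
  srel_sym : forall i, (i <= D)%N -> symmetric (srel i);
  inumP : forall h i j x y, (h <= D)%N -> (i <= D)%N -> (j <= D)%N ->
    srel h x y -> #|[set z | srel i x z && srel j z y]| = inum h i j
}.

Definition polynomial_condition (V : nmodType) (D : nat)
    (p : nat -> nat -> nat -> V) : Prop :=
  forall h i j, (h <= D)%N -> (i <= D)%N -> (j <= D)%N ->
    ([|| i + j < h, h + j < i | h + i < j]%N -> p h i j = 0) /\
    ([|| h == i + j, i == h + j | j == h + i]%N -> p h i j <> 0).

Definition P_polynomial (X : finType) (D : nat) (Y : assoc_scheme X D) : Prop :=
  polynomial_condition D (inum Y).

Definition almost_bipartite (X : finType) (D : nat) (Y : assoc_scheme X D) :
    Prop :=
  (forall i, (i < D)%N -> inum Y i 1%N i = 0%N) /\ inum Y D 1%N D <> 0%N.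

(* Matrices with rows and columns indexed by X have type 'M[C]_#|X|, with X
   enumerated by [enum_val]; C^X is the space of column vectors. *)

Definition assoc_mx (C : numClosedFieldType) (X : finType) (D : nat)
    (Y : assoc_scheme X D) (i : nat) : 'M[C]_#|X| :=
  \matrix_(u, v) (Y i (enum_val u) (enum_val v))%:R.

Definition bose_mesner (C : numClosedFieldType) (X : finType) (D : nat)
    (Y : assoc_scheme X D) : {vspace 'M[C]_#|X|} :=
  <<[seq assoc_mx C Y i | i <- iota 0 D.+1]>>%VS.

(* Primitivity is encoded by the count: M has dimension D+1, so D+1 nonzero
   orthogonal idempotents of M form a basis of M and each E_i M is a line. *)
Record primitive_idempotents (C : numClosedFieldType) (X : finType) (D : nat)
    (Y : assoc_scheme X D) := PrimitiveIdempotents {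
  idem :> nat -> 'M[C]_#|X|;
  (* [krein h i j] is q^h_{ij} *)
  krein : nat -> nat -> nat -> C;
  idem_BM : forall i, (i <= D)%N -> idem i \in bose_mesner C Y;
  idem_neq0 : forall i, (i <= D)%N -> idem i != 0;
  idem_mul : forall i j, (i <= D)%N -> (j <= D)%N ->
    idem i *m idem j = if i == j then idem i else 0;
  idem_sum : \sum_(0 <= i < D.+1) idem i = 1%:M;
  idem0 : idem 0%N = (#|X|%:R)^-1 *: const_mx 1;
  kreinP : forall i j, (i <= D)%N -> (j <= D)%N ->
    map2_mx *%R (idem i) (idem j) =
    (#|X|%:R)^-1 *: \sum_(0 <= h < D.+1) krein h i j *: idem h
}.

Definition Q_polynomial (C : numClosedFieldType) (X : finType) (D : nat)
    (Y : assoc_scheme X D) (E : primitive_idempotents C Y) : Prop :=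
  polynomial_condition D (krein E).

(* E*_i = E*_i(x), indexed by int so that E*_i = 0 for i outside [0, D]. *)
Definition dual_idem (C : numClosedFieldType) (X : finType) (D : nat)
    (Y : assoc_scheme X D) (x : X) (i : int) : 'M[C]_#|X| :=
  match i with
  | Posz k =>
      if (k <= D)%N then diag_mx (\row_(v < #|X|) (Y k x (enum_val v))%:R) else 0
  | Negz _ => 0
  end.

Definition dual_bose_mesner (C : numClosedFieldType) (X : finType) (D : nat)
    (Y : assoc_scheme X D) (x : X) : {vspace 'M[C]_#|X|} :=
  <<[seq dual_idem C Y x (Posz i) | i <- iota 0 D.+1]>>%VS.

Definition dual_assoc_mx (C : numClosedFieldType) (X : finType) (D : nat)
    (Y : assoc_scheme X D) (E : primitive_idempotents C Y) (x : X) :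
    'M[C]_#|X| :=
  diag_mx (\row_(v < #|X|) (#|X|%:R * E 1%N (enum_rank x) v)).

(* Membership in T = T(x); the identity matrix is in M. *)
Inductive terwilliger (C : numClosedFieldType) (X : finType) (D : nat)
    (Y : assoc_scheme X D) (x : X) : 'M[C]_#|X| -> Prop :=
| terwilliger_BM B of B \in bose_mesner C Y : terwilliger Y x B
| terwilliger_dual B of B \in dual_bose_mesner C Y x : terwilliger Y x B
| terwilliger_add B1 B2 of terwilliger Y x B1 & terwilliger Y x B2 :
    terwilliger Y x (B1 + B2)
| terwilliger_scale a B of terwilliger Y x B : terwilliger Y x (a *: B)
| terwilliger_mul B1 B2 of terwilliger Y x B1 & terwilliger Y x B2 :
    terwilliger Y x (B1 *m B2).

Definition T_module (C : numClosedFieldType) (X : finType) (D : nat)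
    (Y : assoc_scheme X D) (x : X) (W : {vspace 'cV[C]_#|X|}) : Prop :=
  forall B v, terwilliger Y x B -> v \in W -> B *m v \in W.

Definition irreducible_T_module (C : numClosedFieldType) (X : finType)
    (D : nat) (Y : assoc_scheme X D) (x : X) (W : {vspace 'cV[C]_#|X|}) :
    Prop :=
  [/\ T_module Y x W, W <> 0%VS &
      forall U : {vspace 'cV[C]_#|X|},
        T_module Y x U -> (U <= W)%VS -> U = 0%VS \/ U = W].

Definition raising (C : numClosedFieldType) (X : finType) (D : nat)
    (Y : assoc_scheme X D) (x : X) : 'M[C]_#|X| :=
  \sum_(0 <= i < D.+1)
    dual_idem C Y x (i%:Z + 1) *m assoc_mx C Y 1%N *m dual_idem C Y x i%:Z.

Definition flat (C : numClosedFieldType) (X : finType) (D : nat)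
    (Y : assoc_scheme X D) (x : X) : 'M[C]_#|X| :=
  \sum_(0 <= i < D.+1)
    dual_idem C Y x i%:Z *m assoc_mx C Y 1%N *m dual_idem C Y x i%:Z.

Definition lowering (C : numClosedFieldType) (X : finType) (D : nat)
    (Y : assoc_scheme X D) (x : X) : 'M[C]_#|X| :=
  \sum_(0 <= i < D.+1)
    dual_idem C Y x (i%:Z - 1) *m assoc_mx C Y 1%N *m dual_idem C Y x i%:Z.

Definition mx_image (C : numClosedFieldType) (n : nat) (B : 'M[C]_n)
    (W : {vspace 'cV[C]_n}) : {vspace 'cV[C]_n} :=
  (linfun (mulmx B) @: W)%VS.

Definition endpoint (C : numClosedFieldType) (X : finType) (D : nat)
    (Y : assoc_scheme X D) (x : X) (W : {vspace 'cV[C]_#|X|}) : nat :=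
  find (fun i : nat => mx_image (dual_idem C Y x i%:Z) W != 0%VS) (iota 0 D.+1).

Definition dual_endpoint (C : numClosedFieldType) (X : finType) (D : nat)
    (Y : assoc_scheme X D) (E : primitive_idempotents C Y)
    (W : {vspace 'cV[C]_#|X|}) : nat :=
  find (fun i : nat => mx_image (E i) W != 0%VS) (iota 0 D.+1).

Definition diameter (C : numClosedFieldType) (X : finType) (D : nat)
    (Y : assoc_scheme X D) (x : X) (W : {vspace 'cV[C]_#|X|}) : nat :=
  (#|[set i : 'I_D.+1 | mx_image (dual_idem C Y x (Posz i)) W != 0%VS]| - 1)%N.

(* The scalar s such that B1 v = s B2 v for every nonzero v in E_t W, where t
   is the dual endpoint of W (and 0 if there is no such scalar). *)
Definition module_scalar (C : numClosedFieldType) (X : finType) (D : nat)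
    (Y : assoc_scheme X D) (E : primitive_idempotents C Y)
    (W : {vspace 'cV[C]_#|X|}) (B1 B2 : 'M[C]_#|X|) : C :=
  xget 0 [set s : C | forall v : 'cV[C]_#|X|,
    v \in mx_image (E (dual_endpoint E W)) W -> v != 0 ->
    B1 *m v = s *: (B2 *m v)]%classic.

Definition c_num (C : numClosedFieldType) (X : finType) (D : nat)
    (Y : assoc_scheme X D) (E : primitive_idempotents C Y) (x : X)
    (W : {vspace 'cV[C]_#|X|}) (i : nat) : C :=
  let k : int := (endpoint Y x W)%:Z + i%:Z in
  module_scalar E W (raising C Y x *m dual_idem C Y x (k - 1))
    (dual_idem C Y x k).

Definition a_num (C : numClosedFieldType) (X : finType) (D : nat)
    (Y : assoc_scheme X D) (E : primitive_idempotents C Y) (x : X)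
    (W : {vspace 'cV[C]_#|X|}) (i : nat) : C :=
  let k : int := (endpoint Y x W)%:Z + i%:Z in
  module_scalar E W (flat C Y x *m dual_idem C Y x k) (dual_idem C Y x k).

Definition b_num (C : numClosedFieldType) (X : finType) (D : nat)
    (Y : assoc_scheme X D) (E : primitive_idempotents C Y) (x : X)
    (W : {vspace 'cV[C]_#|X|}) (i : nat) : C :=
  let k : int := (endpoint Y x W)%:Z + i%:Z in
  module_scalar E W (lowering C Y x *m dual_idem C Y x (k + 1))
    (dual_idem C Y x k).

(* Main.v *)
(* Pick v <> 0 in E_t W that is an eigenvector of E_t A* E_t, with eigenvalue
   alpha.  Since E_k A* E_t = 0 for k > t + 1, both (A - theta_t) v = 0 and
   (A - theta_{t+1}) (A* - alpha) v = 0.  Projecting the two equations on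
   E*_i C^X gives two linear equations for the vectors R E*_{i-1} v,
   F E*_i v, L E*_{i+1} v.  One of the last two vanishes (F E*_i = 0 for i < D,
   and L E*_{D+1} = 0) and the theta*_i are distinct, so all three vectors are
   explicit multiples of E*_i v.  Hence the E*_i v span a T-submodule, which is
   W: every E*_i W is spanned by E*_i v.  If L E*_j v = 0 with E*_j v <> 0 and
   j > r, then the E*_k v with k >= j would span a proper submodule; this shows
   that E*_i v <> 0 exactly for r <= i <= r + d and that E_t W = C v.  The
   multiples found above are therefore the intersection numbers. *)

Require Import Defs.
From HB Require Import structures.
From mathcomp Require Import all_boot all_order all_algebra.
From mathcomp Require Import mathcomp_extra boolp classical_sets reals.
From mathcomp Require Import complex.
From mathcomp Require Import spectral ring zify.

Set Implicit Arguments.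
Unset Strict Implicit.
Unset Printing Implicit Defensive.

Import Order.TTheory GRing.Theory Num.Theory.

Local Open Scope ring_scope.

(** * Linear algebra *)

(** Row [i] of [M] holds the coordinates of [B *m e_i] in a basis of [V]. Since [eigenvalue]
    concerns row vectors, [u *m M = a *: u] says that the combination of the basis with coefficients
    [u] is an eigenvector of [B]. *)
Lemma stable_eigenvector (C : numClosedFieldType) n (V : {vspace 'cV[C]_n})
    (B : 'M[C]_n) :
  V != 0%VS -> (forall v, v \in V -> B *m v \in V) ->
  exists a v, [/\ v \in V, v != 0 & B *m v = a *: v].
Proof.
move=> V0 stabV; pose e := vbasis V.
have Vgt0 : (0 < \dim V)%N by rewrite lt0n dimv_eq0.
pose M : 'M_(\dim V) := \matrix_(i, j) coord e j (B *m e`_i).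
have [a /eigenvalueP [u uM u0]] := eigenvalue_closed M Vgt0.
have freee : free e by apply: basis_free (vbasisP V).
exists a, (\sum_i u 0 i *: e`_i); split.
- by apply: memv_suml => i _; rewrite memvZ// vbasis_mem// mem_nth// size_tuple.
- apply: contra u0 => /eqP s0; apply/eqP/rowP => i.
  by rewrite mxE; move/freeP: freee => /(_ (fun i => u 0 i)); apply.
have Be (i : 'I_(\dim V)) : B *m e`_i = \sum_j M i j *: e`_j.
  under eq_bigr do rewrite mxE; apply: coord_vbasis.
  by rewrite stabV// vbasis_mem// mem_nth// size_tuple.
rewrite mulmx_sumr scaler_sumr.
under eq_bigr => i _.
  rewrite -scalemxAr Be scaler_sumr; under eq_bigr do rewrite scalerA.
  over.
rewrite exchange_big; apply: eq_bigr => j _ /=.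
rewrite -scaler_suml scalerA; congr (_ *: _).
by move/rowP/(_ j): uM; rewrite !mxE.
Qed.

(** Cramer's rule for the first unknown; exchanging the summands gives the second. *)
Lemma solve_pair (F : fieldType) (V : lmodType F) (u w z : V) (x y a b : F) :
  x != y -> u + w = a *: z -> x *: u + y *: w = b *: z ->
  u = ((b - y * a) / (x - y)) *: z.
Proof.
move=> xy e1 e2; rewrite mulrC -scalerA scalerBl -e2 -scalerA -e1.
by rewrite [y *: (u + w)]scalerDr opprD addrACA subrr addr0 -scalerBl scalerK // subr_eq0.
Qed.

(** * Abstract form of the argument, with [S i] for E*_i, [B] for A* and [ths i] for theta*_i *)

Section Tridiagonal.

Variables (F : fieldType) (n D : nat) (A B : 'M[F]_n) (S : nat -> 'M[F]_n).
Variable (ths : nat -> F).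
Hypothesis D_gt0 : (0 < D)%N.
Hypothesis S_mul : forall i j, S i *m S j = if i == j then S i else 0.
Hypothesis S_oob : forall i, (D < i)%N -> S i = 0.
Hypothesis S_sum : \sum_(i < D.+1) S i = 1%:M.
Hypothesis S_tri : forall i j, ((i.+1 < j) || (j.+1 < i))%N ->
  S i *m A *m S j = 0.
Hypothesis S_flat : forall i, (i < D)%N -> S i *m A *m S i = 0.
Hypothesis S_B : forall i, S i *m B = ths i *: S i.
Hypothesis ths_inj : forall i j, (i <= D)%N -> (j <= D)%N ->
  ths i = ths j -> i = j.

Lemma sum_S (u : 'cV_n) : \sum_(i < D.+1) S i *m u = u.
Proof. by rewrite -mulmx_suml S_sum mul1mx. Qed.

Lemma S_eq0 (u : 'cV_n) : (forall i, (i <= D)%N -> S i *m u = 0) -> u = 0.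
Proof. by move=> S0; rewrite -[u]sum_S big1// => i _; rewrite S0// -ltnS. Qed.

Lemma S_mulv i j (u : 'cV_n) :
  S i *m (S j *m u) = if i == j then S i *m u else 0.
Proof. by rewrite mulmxA S_mul; case: ifP => // _; rewrite mul0mx. Qed.

(* The parts of [S i *m A *m u] coming from components [i.-1], [i] and [i.+1]
   of [u], i.e. [S i] applied to [R u], [F u] and [L u]. *)
Definition rpart (u : 'cV[F]_n) i : 'cV[F]_n :=
  if i is j.+1 then S i *m (A *m (S j *m u)) else 0.
Definition fpart (u : 'cV[F]_n) i : 'cV[F]_n := S i *m (A *m (S i *m u)).
Definition lpart (u : 'cV[F]_n) i : 'cV[F]_n := S i *m (A *m (S i.+1 *m u)).

Lemma S_A_far i j (u : 'cV_n) : ((i.+1 < j) || (j.+1 < i))%N ->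
  S i *m (A *m (S j *m u)) = 0.
Proof. by move=> ij; rewrite !mulmxA S_tri// mul0mx. Qed.

Lemma S_A_parts u i : S i *m (A *m u) = rpart u i + fpart u i + lpart u i.
Proof.
case: (leqP i D) => [iD|Di]; last first.
  by rewrite /fpart /lpart /rpart; case: i Di => [//|i] Di; rewrite S_oob// !mul0mx !addr0.
rewrite -{1}[u]sum_S !mulmx_sumr.
pose G j := S i *m (A *m (S j *m u)).
have G0 j : ((i.+1 < j) || (j.+1 < i))%N -> G j = 0 by exact: S_A_far.
have GD j : (D < j)%N -> G j = 0 by move=> Dj; rewrite /G (S_oob Dj) mul0mx !mulmx0.
(* The zero term [j = D.+1] is added so that [i.+1] is in range even for [i = D]; tridiagonality
   then leaves only the three indices next to [i]. *)
have -> : \sum_(j < D.+1) S i *m (A *m (S j *m u)) = \sum_(0 <= j < D.+2) G j.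
  by rewrite [RHS]big_nat_recr//= GD// addr0 big_mkord.
rewrite (big_cat_nat _ (n := i))//=; last lia.
rewrite (big_cat_nat _ (n := i.+2) (m := i))//=; try lia.
rewrite [X in _ + (_ + X)]big_nat_cond [X in _ + (_ + X)]big1 ?addr0; last first.
  by move=> j /andP[/andP[ij _] _]; rewrite G0// ij.
rewrite big_nat_recr//= big_nat1 addrA; congr (_ + _ + _).
rewrite /rpart; case: i {iD} @G G0 {GD} => [|i] G G0; first by rewrite big_nil.
rewrite big_nat_recr//= big_nat_cond big1 ?add0r// => j /andP[/andP[_ ij] _].
by rewrite G0// !ltnS ij orbT.
Qed.

Lemma fpart_eq0 u i : (i < D)%N -> fpart u i = 0.
Proof. by move=> iD; rewrite /fpart !mulmxA S_flat// mul0mx. Qed.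

Lemma lpart_oob u i : (D <= i)%N -> lpart u i = 0.
Proof. by move=> iD; rewrite /lpart [S i.+1]S_oob// mul0mx !mulmx0. Qed.

(** * Components of the eigenvector [v] and the submodule they span *)

Variables (W : {vspace 'cV[F]_n}) (th th' al : F) (v : 'cV[F]_n).
Hypothesis W_S : forall i u, u \in W -> S i *m u \in W.
Hypothesis W_irr : forall U : {vspace 'cV[F]_n}, (U <= W)%VS ->
  (forall u, u \in U -> A *m u \in U) ->
  (forall i u, u \in U -> S i *m u \in U) -> U = 0%VS \/ U = W.
Hypotheses (vW : v \in W) (v_neq0 : v != 0).
Hypothesis A_v : A *m v = th *: v.
Hypothesis A_Bv : A *m (B *m v - al *: v) = th' *: (B *m v - al *: v).

(** [A_v] and [A_Bv] rearrange to [A B v = th' B v + kap v]. *)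
Let kap := al * (th - th').

(* [balance] and [dual_balance] determine two of the three parts as multiples of
   [S i *m v], the third one being zero. *)
Lemma balance i : rpart v i + fpart v i + lpart v i = th *: (S i *m v).
Proof. by rewrite -S_A_parts A_v -scalemxAr. Qed.

Lemma dual_balance i :
  ths i.-1 *: rpart v i + ths i *: fpart v i + ths i.+1 *: lpart v i =
  (th' * ths i + kap) *: (S i *m v).
Proof.
have SB j : S j *m (B *m v) = ths j *: (S j *m v).
  by rewrite mulmxA S_B scalemxAl.
(* Both sides equal [S i A B v]: the right one by [A_v] and [A_Bv], the left one by splitting
   [B *m v] into components. The out-of-range indices at [i = 0] and [i = D] only multiply zero
   parts. *)
have -> : (th' * ths i + kap) *: (S i *m v) = S i *m (A *m (B *m v)).
  have -> : A *m (B *m v) = (al * th) *: v + th' *: (B *m v - al *: v).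
    by rewrite -A_Bv mulmxBr -scalemxAr A_v scalerA addrC subrK.
  rewrite mulmxDr -!scalemxAr mulmxBr SB -scalemxAr scalerBr !scalerA.
  by rewrite -scalerBl -scalerDl; congr (_ *: _); rewrite /kap; ring.
rewrite S_A_parts; congr (_ + _ + _).
- by case: i => [|i]; rewrite /rpart ?scaler0//= SB -!scalemxAr.
- by rewrite /fpart SB -!scalemxAr.
by rewrite /lpart SB -!scalemxAr.
Qed.

Lemma lpart_first : lpart v 0 = th *: (S 0%N *m v).
Proof. by rewrite -balance fpart_eq0// /rpart addr0 add0r. Qed.

Lemma rpart_inner i : (0 < i < D)%N ->
  rpart v i = ((th' * ths i + kap - ths i.+1 * th) / (ths i.-1 - ths i.+1))
           *: (S i *m v).
Proof.
move=> /andP[i0 iD]; have := dual_balance i; have := balance i.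
rewrite fpart_eq0// scaler0 !addr0; apply: solve_pair.
by apply/eqP => /ths_inj; lia.
Qed.

Lemma lpart_inner i : (0 < i < D)%N ->
  lpart v i = ((th' * ths i + kap - ths i.-1 * th) / (ths i.+1 - ths i.-1))
             *: (S i *m v).
Proof.
move=> /andP[i0 iD]; have := dual_balance i; have := balance i.
rewrite fpart_eq0// scaler0 !addr0 [X in X = _ -> _]addrC.
rewrite [X in _ -> X = _ -> _]addrC; apply: solve_pair.
by apply/eqP => /ths_inj; lia.
Qed.

(** The condition [lpart v i = 0] holds at [i = D], and also at the last index of the support of
    [v], which may be smaller than [D]. *)
Lemma rpart_last i : (0 < i <= D)%N -> lpart v i = 0 ->
  rpart v i = ((th' * ths i + kap - ths i * th) / (ths i.-1 - ths i))
           *: (S i *m v).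
Proof.
move=> /andP[i0 iD] d0; have := dual_balance i; have := balance i.
rewrite d0 scaler0 !addr0; apply: solve_pair.
by apply/eqP => /ths_inj; lia.
Qed.

Lemma fpart_last i : (0 < i <= D)%N -> lpart v i = 0 ->
  fpart v i = ((th' * ths i + kap - ths i.-1 * th) / (ths i - ths i.-1))
           *: (S i *m v).
Proof.
move=> /andP[i0 iD] d0; have := dual_balance i; have := balance i.
rewrite d0 scaler0 !addr0 [X in X = _ -> _]addrC.
rewrite [X in _ -> X = _ -> _]addrC; apply: solve_pair.
by apply/eqP => /ths_inj; lia.
Qed.

(** For [0 < i < D] the flat part is zero and for [i = D] the lowering part is, so the two balance
    equations determine the others; at [i = 0] the first equation is enough. Hence [A] preserves the
    span of the components of [v]. *)
Lemma S_A_line i j : exists c, S i *m (A *m (S j *m v)) = c *: (S i *m v).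
Proof.
have zero u : u = 0 -> exists c, u = c *: (S i *m v).
  by move=> ->; exists 0; rewrite scale0r.
have [Di|iD] := ltnP D i; first by apply: zero; rewrite S_oob// mul0mx.
case: (ltngtP i j) => [ij|ji|<-].
- have [ij'|ij'] := ltnP i.+1 j; first by apply: zero; rewrite S_A_far// ij'.
  have -> : j = i.+1 by lia.
  change (exists c, lpart v i = c *: (S i *m v)).
  have [Di|iD'] := leqP D i; first by apply: zero; rewrite lpart_oob.
  have [->|i0] := posnP i; first by rewrite lpart_first; eexists.
  by rewrite lpart_inner ?i0//; eexists.
- have [ij'|ij'] := ltnP j.+1 i; first by apply: zero; rewrite S_A_far// ij' orbT.
  have -> : i = j.+1 by lia.
  change (exists c, rpart v j.+1 = c *: (S j.+1 *m v)).
  have [iD'|Di] := ltnP j.+1 D; first by rewrite rpart_inner//; eexists.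
  by rewrite rpart_last ?lpart_oob//; [eexists|lia].
change (exists c, fpart v i = c *: (S i *m v)).
have [iD'|Di] := ltnP i D; first by apply: zero; rewrite fpart_eq0.
by rewrite fpart_last ?lpart_oob//; [eexists|lia].
Qed.

(** [tail 0] will be all of [W]; a later tail stable under [A] would cut off the lower components of
    [W]. *)
Definition tail j := <<[seq S i *m v | i <- iota j (D.+1 - j)]>>%VS.

Lemma mem_tail j i : (j <= i)%N -> S i *m v \in tail j.
Proof.
move=> ji; have [Di|iD] := ltnP D i; first by rewrite S_oob// mul0mx mem0v.
by apply: memv_span; apply: map_f; rewrite mem_iota; lia.
Qed.

Lemma tail_stable (U : {vspace 'cV[F]_n}) (M : 'M[F]_n) j :
  (forall i, (j <= i)%N -> M *m (S i *m v) \in U) ->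
  forall u, u \in tail j -> M *m u \in U.
Proof.
move=> MU u uT.
have /memv_img : u \in tail j by [].
move=> /(_ _ (linfun (mulmx M))); rewrite lfunE/= limg_span; apply: subvP.
apply/span_subvP => _ /mapP[_ /mapP[i + ->] ->].
by rewrite mem_iota lfunE/= => /andP[ji _]; apply: MU.
Qed.

Lemma tail_S j i u : u \in tail j -> S i *m u \in tail j.
Proof.
apply: tail_stable => k jk; rewrite S_mulv.
by case: eqP => [->|_]; [apply: mem_tail|apply: mem0v].
Qed.

(** The only way for [A] to leave [tail j] is to lower [S j *m v] to index [j - 1]; for [j = 0]
    there is nothing below. *)
Lemma tail_A j u : (if j is k.+1 then lpart v k = 0 else True) ->
  u \in tail j -> A *m u \in tail j.
Proof.
move=> dj; apply: tail_stable => k jk.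
rewrite -[A *m _]sum_S; apply: memv_suml => i _.
have [c Sc] := S_A_line i k.
have [ji|ij] := leqP j i; first by rewrite Sc memvZ// mem_tail.
suff -> : S i *m (A *m (S k *m v)) = 0 by apply: mem0v.
have [ik|ki] := ltnP i.+1 k; first by rewrite S_A_far// ik.
have ek : k = i.+1 by lia.
have ej : j = i.+1 by lia.
by move: dj; rewrite ej ek.
Qed.

Lemma tail_sub j : (tail j <= W)%VS.
Proof. by apply/span_subvP => _ /mapP[i _ ->]; apply: W_S. Qed.

Lemma tail_eqW j : (if j is k.+1 then lpart v k = 0 else True) ->
  (exists2 i, (j <= i)%N & S i *m v != 0) -> tail j = W.
Proof.
move=> dj [i ji Si0].
have [] := W_irr (tail_sub j) (fun u => tail_A dj) (@tail_S j) => // T0.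
by move: Si0; rewrite -memv0 -T0 mem_tail.
Qed.

Lemma tail0 : tail 0 = W.
Proof.
apply: tail_eqW => //; apply: contrapT => S0; case/eqP: v_neq0.
by apply: S_eq0 => i _; apply: contrapT => /eqP Si; apply: S0; exists i.
Qed.

(** This is thinness of [W], a consequence of [tail 0 = W]. *)
Lemma W_line k w : w \in W -> exists c, S k *m w = c *: (S k *m v).
Proof.
rewrite -tail0 => wT; apply/vlineP; apply: tail_stable wT => i _.
rewrite S_mulv; case: eqP => _; [exact: memv_line|exact: mem0v].
Qed.

(** Here [tail j.+1] is a nonzero submodule, hence equal to [W], and its elements have no component
    of index at most [j]. *)
Lemma lpart_eq0 j : lpart v j = 0 -> S j.+1 *m v != 0 ->
  forall k w, (k <= j)%N -> w \in W -> S k *m w = 0.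
Proof.
move=> dj Sj k w kj; have <- : tail j.+1 = W by apply: tail_eqW => //; exists j.+1.
move=> wT; apply/eqP; rewrite -memv0; apply: tail_stable wT => i ji.
by rewrite S_mulv; case: eqP => [ki|_]; [lia|exact: mem0v].
Qed.

(** * The support of [v] and the [th]-eigenvectors in [W] *)

Variable r : nat.
Hypothesis r_le : (r <= D)%N.
Hypothesis S_r : exists2 w, w \in W & S r *m w != 0.
Hypothesis S_lt_r : forall k w, (k < r)%N -> w \in W -> S k *m w = 0.

Lemma S_r_v : S r *m v != 0.
Proof.
have [w /(W_line r)[c ->]] := S_r.
by apply: contra => /eqP ->; rewrite scaler0.
Qed.

(** If [S k *m v] were zero, so would be its multiple [lpart v k], and [lpart_eq0] would force
    [S r *m v = 0]. *)
Lemma support_pred k : (r <= k)%N -> S k.+1 *m v != 0 -> S k *m v != 0.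
Proof.
move=> rk Sk; apply/eqP => Sk0; have [c dk] := S_A_line k k.+1.
have := S_r_v; rewrite (@lpart_eq0 k)// ?eqxx//.
by rewrite [LHS]dk Sk0 scaler0.
Qed.

(** A multiple of [v] is subtracted so that the component of index [r] vanishes. The eigenvalue
    equation then propagates the vanishing upwards, since lowering does not annihilate the nonzero
    components of [v] above [r]. *)
Lemma eigen_line w : w \in W -> A *m w = th *: w -> exists c, w = c *: v.
Proof.
move=> wW Aw; have [c cE] := W_line r wW; exists c.
apply/eqP; rewrite -subr_eq0; apply/eqP; set u := w - _.
have uW : u \in W by rewrite memvB// memvZ.
have Au : A *m u = th *: u by rewrite mulmxBr -scalemxAr A_v Aw scalerBr !scalerA mulrC.
have Sru : S r *m u = 0 by rewrite mulmxBr -scalemxAr cE subrr.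
suff S0 k i : (i <= k)%N -> S i *m u = 0 by apply: S_eq0 => i; apply: S0.
elim: k i => [|k IH] i; rewrite leq_eqVlt => /predU1P[->|//].
- by have [r0|r0] := posnP r; [move: Sru; rewrite r0|apply: S_lt_r].
- have [kr|rk] := ltnP k.+1 r; first exact: S_lt_r.
  have [->//|krN] := eqVneq k.+1 r.
  have [c' c'E] := W_line k.+1 uW; apply/eqP/negPn/negP => Su0.
  have c'0 : c' != 0 by apply: contra Su0 => /eqP c'0; rewrite c'E c'0 scale0r.
  have Sv0 : S k.+1 *m v != 0.
    by apply: contra Su0 => /eqP Sv; rewrite c'E Sv scaler0.
  (* As the components of [u] up to [k] vanish, component [k] of [A u = th u] reads
     [c' *: lpart v k = 0]. *)
  have := S_A_parts u k; rewrite Au -scalemxAr IH// scaler0.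
  rewrite /fpart IH// !mulmx0 addr0 /lpart c'E -!scalemxAr.
  have -> : rpart u k = 0.
    by case: (k) IH => [//|m] IH; rewrite /rpart IH ?mulmx0.
  rewrite add0r => /esym/eqP; rewrite scaler_eq0 (negPf c'0)/= => /eqP dk.
  by have := S_r_v; rewrite (lpart_eq0 dk)// ?eqxx//; lia.
- by move=> ik; apply: IH.
Qed.

Lemma support : exists2 e, (r <= e <= D)%N &
  forall k, (S k *m v != 0) = (r <= k <= e)%N.
Proof.
have exP : exists k, S k *m v != 0 by exists r; apply: S_r_v.
have leP k : S k *m v != 0 -> (k <= D)%N.
  by apply: contraR; rewrite -ltnNge => Dk; rewrite S_oob// mul0mx.
case: (ex_maxnP exP leP) => e Se maxe.
have re := maxe _ S_r_v.
exists e; first by rewrite re leP.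
move=> k; apply/idP/idP => [Sk|/andP[rk ke]].
  rewrite maxe// andbT leqNgt; apply: contra Sk => kr.
  by rewrite S_lt_r.
(* Downward induction from the largest index [e] of the support, with [k] written as [e - m]. *)
rewrite -(subKn ke); elim: (e - k)%N (leq_sub2l e rk) => [|m IH] me; first by rewrite subn0.
apply: support_pred; first lia.
by rewrite (_ : (e - m.+1).+1 = e - m)%N ?IH; lia.
Qed.

Lemma tridiagonal_module : exists2 e, (r <= e <= D)%N /\
    (forall k w, w \in W -> exists c, S k *m w = c *: (S k *m v)) &
  [/\ forall k, (S k *m v != 0) = (r <= k <= e)%N,
  forall w, w \in W -> A *m w = th *: w -> exists c, w = c *: v,
  forall i, (i < e)%N -> fpart v i = 0,
  e = r -> fpart v r = th *: (S r *m v) &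
  (r < e)%N ->
  [/\ lpart v r = th *: (S r *m v),
    forall i, (r < i < e)%N -> rpart v i =
      ((th * (ths i.+1 - ths r.+1) - th' * (ths i - ths r))
       / (ths i.+1 - ths i.-1)) *: (S i *m v),
    forall i, (r < i < e)%N -> lpart v i =
      ((th * (ths i.-1 - ths r.+1) - th' * (ths i - ths r))
       / (ths i.-1 - ths i.+1)) *: (S i *m v),
    rpart v e = ((th * (ths e - ths r.+1) - th' * (ths e - ths r))
       / (ths e - ths e.-1)) *: (S e *m v) &
    fpart v e = ((th * (ths e.-1 - ths r.+1) - th' * (ths e - ths r))
       / (ths e.-1 - ths e)) *: (S e *m v)]].
Proof.
have [e /andP[re eD] supp] := support; exists e; first by split; [rewrite re|exact: W_line].
have S0 k : ~~ (r <= k <= e)%N -> S k *m v = 0.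
  by rewrite -supp negbK => /eqP.
have rpart_r : rpart v r = 0.
  have Sr k : (k < r)%N -> S k *m v = 0 by move=> kr; apply: S_lt_r.
  by rewrite /rpart; case: (r) Sr => [//|m] -> //; rewrite !mulmx0.
have lpart_e : lpart v e = 0 by rewrite /lpart S0 ?mulmx0//; lia.
split=> //.
- by move=> w; apply: eigen_line.
- by move=> i ie; apply: fpart_eq0; lia.
- by move=> er; rewrite -balance rpart_r -er lpart_e addr0 add0r.
move=> r_lt_e; have fpart_r : fpart v r = 0 by apply: fpart_eq0; lia.
have lpart_r : lpart v r = th *: (S r *m v) by rewrite -balance rpart_r fpart_r !add0r.
(* This eliminates [al]: at index [r] only the lowering part survives, so [dual_balance] compares
   two multiples of the nonzero vector [S r *m v]. *)
have kapE : kap = ths r.+1 * th - th' * ths r.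
  have := dual_balance r; rewrite rpart_r fpart_r !scaler0 !add0r lpart_r scalerA.
  move/eqP; rewrite -subr_eq0 -scalerBl scaler_eq0 (negPf S_r_v) orbF subr_eq0.
  by move=> /eqP ->; ring.
(* The fractions obtained from [solve_pair] have numerator and denominator of opposite sign. *)
have neg (a b c d : F) : a = - c -> b = - d -> a / b = c / d.
  by move=> -> ->; rewrite invrN mulrNN.
split=> // [i ri|i ri||].
- by rewrite rpart_inner ?kapE; [congr (_ *: _); apply: neg; ring|lia].
- by rewrite lpart_inner ?kapE; [congr (_ *: _); apply: neg; ring|lia].
- by rewrite rpart_last ?kapE; [congr (_ *: _); apply: neg; ring|lia|].
- by rewrite fpart_last ?kapE; [congr (_ *: _); apply: neg; ring|lia|].
Qed.

End Tridiagonal.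

(** * The Bose-Mesner algebra and the matrices E*_i, A* *)

Lemma span_iotaP (F : fieldType) (V : vectType F) (f : nat -> V) m w :
  w \in <<[seq f i | i <- iota 0 m]>>%VS ->
  exists c : 'I_m -> F, w = \sum_i c i *: f i.
Proof.
rewrite -val_enum_ord -map_comp => wS.
have := @coord_span _ _ _ [tuple f i | i < m] w wS => ->.
exists (fun i => coord [tuple f i | i < m] i w).
by apply: eq_bigr => i _; rewrite -tnth_nth tnth_mktuple.
Qed.

Lemma span_mulmx (F : fieldType) n m (s : seq 'M[F]_n) (B : 'M[F]_n)
    (u : 'M[F]_(n, m)) (U : {vspace 'M[F]_(n, m)}) :
  B \in <<s>>%VS -> (forall M, M \in s -> M *m u \in U) -> B *m u \in U.
Proof.
move=> /(memv_img (linfun (mulmxr u))) + sU.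
rewrite lfunE/= limg_span; apply: subvP; apply/span_subvP => _ /mapP[M Ms ->].
by rewrite lfunE/=; apply: sU.
Qed.

Lemma natr_card (R : pzSemiRingType) (T : finType) (p : pred T) :
  #|[set z | p z]|%:R = \sum_(z in T) (p z)%:R :> R.
Proof.
rewrite -sum1_card natr_sum big_mkcond; apply: eq_bigr => z _.
by rewrite inE; case: (p z).
Qed.

Section Scheme.

Variables (C : numClosedFieldType) (X : finType) (D : nat).
Variables (Y : assoc_scheme X D) (x : X).

Local Notation n := #|X|.
Local Notation A := (assoc_mx C Y).
Local Notation S i := (dual_idem C Y x (Posz i)).

Lemma srel_uniq i j u v : (i <= D)%N -> (j <= D)%N -> Y i u v ->
  Y j u v = (i == j).
Proof.
move=> iD jD Yi; apply/idP/eqP => [Yj|<-//].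
exact: srel_disjoint Yi Yj.
Qed.

Lemma assoc_mx0 : A 0 = 1%:M.
Proof. by apply/matrixP => i j; rewrite !mxE srel0 (inj_eq enum_val_inj). Qed.

Lemma assoc_mx_mul i j : (i <= D)%N -> (j <= D)%N ->
  A i *m A j = \sum_(h < D.+1) (inum Y h i j)%:R *: A h.
Proof.
move=> iD jD; apply/matrixP => k l; rewrite !mxE summxE.
have [h hD Yh] := srel_cover Y (enum_val k) (enum_val l).
rewrite (bigD1 (Ordinal (hD : (h < D.+1)%N)))//= !mxE Yh mulr1 [X in _ + X]big1 ?addr0; last first.
  move=> h' hh'; rewrite !mxE (srel_uniq hD (leq_ord h') Yh).
  by move: hh'; rewrite -val_eqE/= eq_sym => /negPf ->; rewrite mulr0.
rewrite -(inumP hD iD jD Yh) natr_card.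
rewrite (big_enum_val (fun z => (Y i (enum_val k) z && Y j z (enum_val l))%:R)).
by apply: eq_bigr => z _; rewrite !mxE -natrM mulnb.
Qed.

Lemma dual_idem_oob i : (D < i)%N -> S i = 0.
Proof. by move=> Di; rewrite /dual_idem leqNgt Di. Qed.

Lemma dual_idem_mul i j : S i *m S j = if i == j then S i else 0.
Proof.
have [Di|iD] := ltnP D i; first by rewrite dual_idem_oob// mul0mx if_same.
have [Dj|jD] := ltnP D j.
  by rewrite (dual_idem_oob Dj) mulmx0; case: eqP => // ij; move: iD; rewrite ij leqNgt Dj.
rewrite /dual_idem iD jD mulmx_diag.
apply/matrixP => k l; rewrite !mxE.
case: ifP => [/eqP <-|ij]; rewrite !mxE; first by rewrite -natrM mulnb andbb.
case: (boolP (Y i x (enum_val k))) => Yi; last by rewrite mul0r mul0rn.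
by rewrite (srel_uniq iD jD Yi) ij mulr0 mul0rn.
Qed.

Lemma dual_idem_sum : \sum_(i < D.+1) S i = 1%:M.
Proof.
apply/matrixP => k l; rewrite !mxE summxE.
have [h hD Yh] := srel_cover Y x (enum_val k).
rewrite (bigD1 (Ordinal (hD : (h < D.+1)%N)))//= hD !mxE Yh big1 ?addr0// => h' hh'.
rewrite -ltnS ltn_ord !mxE (srel_uniq hD (leq_ord h') Yh).
by move: hh'; rewrite -val_eqE/= eq_sym => /negPf ->; rewrite mul0rn.
Qed.

Lemma dual_idem_assoc i j h k l : (i <= D)%N -> (j <= D)%N ->
  (S i *m A h *m S j) k l = (Y i x (enum_val k) && Y h (enum_val k) (enum_val l)
    && Y j x (enum_val l))%:R.
Proof.
by move=> iD jD; rewrite /dual_idem iD jD mul_diag_mx mul_mx_diag !mxE -!natrM !mulnb.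
Qed.

Hypothesis D_gt0 : (0 < D)%N.

(** A nonzero entry at [(k, l)] would make the vertex of [l] one of those counted by [inum Y i 1 j]
    for the vertex of [k] and [x]. *)
Lemma dual_idem_assoc_eq0 i j : inum Y i 1 j = 0%N -> S i *m A 1 *m S j = 0.
Proof.
move=> p0; have [Di|iD] := ltnP D i; first by rewrite dual_idem_oob// !mul0mx.
have [Dj|jD] := ltnP D j; first by rewrite (dual_idem_oob Dj) !mulmx0.
apply/matrixP => k l; rewrite dual_idem_assoc// mxE.
case: (boolP (_ && _)) => // /andP[/andP[Yi Yh] Yj].
have := @inumP _ _ Y i 1 j (enum_val k) x iD D_gt0 jD.
rewrite srel_sym// p0 => /(_ Yi)/eqP; rewrite cards_eq0 => /eqP/setP/(_ (enum_val l)).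
by rewrite !inE Yh srel_sym// Yj.
Qed.

Hypothesis Pp : P_polynomial Y.

Lemma dual_idem_tri i j : ((i.+1 < j) || (j.+1 < i))%N -> S i *m A 1 *m S j = 0.
Proof.
move=> ij; have [Di|iD] := ltnP D i; first by rewrite dual_idem_oob// !mul0mx.
have [Dj|jD] := ltnP D j; first by rewrite (dual_idem_oob Dj) !mulmx0.
apply: dual_idem_assoc_eq0; have [+ _] := Pp iD D_gt0 jD; apply.
by apply/or3P; case/orP: ij => ij; [constructor 3|constructor 1]; lia.
Qed.

Lemma dual_idem_flat i : almost_bipartite Y -> (i < D)%N -> S i *m A 1 *m S i = 0.
Proof. by move=> [ab _] iD; apply/dual_idem_assoc_eq0/ab. Qed.

(** The P-polynomial condition makes the valency p^0_{ii} nonzero, and it counts the [i]-neighbours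
    of any vertex. *)
Lemma srel_nbr i u : (i <= D)%N -> exists y, Y i u y.
Proof.
move=> iD; have [_] := Pp (leq0n D) iD iD; rewrite eqxx !orbT => /(_ isT) p.
have := inumP (leq0n D) iD iD (etrans (srel0 Y u u) (eqxx u)).
move=> pE; rewrite -pE in p.
have /card_gt0P[z] : (0 < #|[set z | Y i u z && Y i z u]|)%N by rewrite lt0n; apply/eqP.
by rewrite inE => /andP[Yz _]; exists z.
Qed.

(** * Subspaces stable under [A] and all E*_i are T-modules *)

Section Stable.
Variable (U : {vspace 'cV[C]_n}).
Hypothesis UA : forall u, u \in U -> A 1 *m u \in U.

(** Since p^{i+1}_{1i} is nonzero, the product of A_1 and A_i expresses A_{i+1} through that product
    and the A_h with [h <= i]. *)
Lemma assoc_mx_stable i u : (i <= D)%N -> u \in U -> A i *m u \in U.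
Proof.
move=> + uU; elim/ltn_ind: i => -[|i] IH iD; first by rewrite assoc_mx0 mul1mx.
have [i0|i0] := posnP i; first by rewrite i0 UA.
have /(congr1 (mulmx^~ u)) := assoc_mx_mul D_gt0 (ltnW iD).
rewrite /= mulmx_suml (bigD1 (Ordinal (iD : (i.+1 < D.+1)%N)))//=.
move=> /esym/(canRL (addrK _)) e.
have [_ p] := Pp iD D_gt0 (ltnW iD); move: p; rewrite add1n eqxx => /(_ isT)/eqP p.

have : (inum Y i.+1 1 i)%:R *: (A i.+1 *m u) \in U.
  rewrite scalemxAl e memvB//; first by rewrite -mulmxA UA// IH// ltnW.
  apply: memv_suml => h hi; rewrite -scalemxAl.
  have [ih|hi'] := ltnP i.+1 h.
    have [+ _] := Pp (leq_ord h) D_gt0 (ltnW iD).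
    by rewrite add1n ih => /(_ isT) ->; rewrite scale0r mem0v.
  rewrite memvZ// IH ?leq_ord// ltn_neqAle hi' andbT.
  by apply: contra hi => /eqP hE; apply/eqP/val_inj.
by rewrite rpredZeq pnatr_eq0 (negPf p).
Qed.

Hypothesis US : forall i u, u \in U -> S i *m u \in U.

Lemma T_module_of_stable : T_module Y x U.
Proof.
move=> B u TB; elim: TB u => {B}.
- move=> B BM u uU; apply: span_mulmx BM _ => _ /mapP[i + ->].
  by rewrite mem_iota => iD; apply: assoc_mx_stable.
- move=> B BM u uU; apply: span_mulmx BM _ => _ /mapP[i _ ->]; exact: US.
- by move=> B1 B2 _ IH1 _ IH2 u uU; rewrite mulmxDl memvD ?IH1 ?IH2.
- by move=> a B _ IH u uU; rewrite -scalemxAl memvZ ?IH.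
- by move=> B1 B2 _ IH1 _ IH2 u uU; rewrite -mulmxA; apply/IH1/IH2.
Qed.

End Stable.

(** * Primitive idempotents, Krein parameters and eigenvalues *)

Variable (E : primitive_idempotents C Y).

Local Notation conj_mx := (map_mx (Num.conj : C -> C)).
Local Notation BM := (bose_mesner C Y).

Lemma bose_mesnerP B : B \in BM -> exists c : 'I_D.+1 -> C, B = \sum_i c i *: A i.
Proof. exact: span_iotaP. Qed.

Lemma assoc_mx_BM i : (i <= D)%N -> A i \in BM.
Proof. by move=> iD; apply: memv_span; apply: map_f; rewrite mem_iota. Qed.

Lemma assoc_mx_tr i : (i <= D)%N -> (A i)^T = A i.
Proof. by move=> iD; apply/matrixP => k l; rewrite !mxE srel_sym. Qed.

Lemma assoc_mx_conj i : conj_mx (A i) = A i.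
Proof. by apply/matrixP => k l; rewrite !mxE conjC_nat. Qed.

Lemma bose_mesner_tr B : B \in BM -> B^T = B.
Proof.
move=> /bose_mesnerP[c ->]; rewrite linear_sum; apply: eq_bigr => i _ /=.
by rewrite linearZ/= assoc_mx_tr// leq_ord.
Qed.

Lemma bose_mesner_conj B : B \in BM -> conj_mx B \in BM.
Proof.
move=> /bose_mesnerP[c ->]; rewrite raddf_sum; apply: memv_suml => i _.
by rewrite /= map_mxZ assoc_mx_conj memvZ// assoc_mx_BM// leq_ord.
Qed.

(** Elements of [BM] are symmetric, so transposing a product swaps its factors. *)
Lemma bose_mesner_comm B1 B2 : B1 \in BM -> B2 \in BM ->
  B1 *m B2 \in BM -> B1 *m B2 = B2 *m B1.
Proof.
by move=> B1M B2M BM12; rewrite -(bose_mesner_tr BM12) trmx_mul !bose_mesner_tr.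
Qed.

(** Nonzero orthogonal idempotents are linearly independent, and [BM] is spanned by [D.+1]
    matrices. *)
Lemma idem_basis : BM = <<[seq E i | i <- iota 0 D.+1]>>%VS.
Proof.
apply/esym/eqP; rewrite eqEdim; apply/andP; split.
  apply/span_subvP => _ /mapP[i + ->]; rewrite mem_iota => iD.
  exact: idem_BM.
rewrite (leq_trans (dim_span _))// size_map size_iota.
suff /eqP -> : free [seq E i | i <- iota 0 D.+1] by rewrite size_map size_iota.
rewrite -val_enum_ord -map_comp; change (free [tuple E i | i < D.+1]).
apply/freeP => c c0 i.
have En (j : 'I_D.+1) : [seq E (nat_of_ord k) | k <- enum 'I_D.+1]`_j = E j.
  by rewrite (nth_map j) ?size_enum_ord// nth_ord_enum.
have := congr1 (mulmx^~ (E i)) c0; rewrite mul0mx mulmx_suml (bigD1 i)//=.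
rewrite big1 => [|j ji]; rewrite En -scalemxAl idem_mul ?leq_ord//.
  rewrite eqxx addr0 => /eqP; rewrite scaler_eq0 (negPf (idem_neq0 _ _)) ?leq_ord//.
  by rewrite orbF => /eqP.
by rewrite val_eqE (negPf ji) scaler0.
Qed.

Lemma bose_mesner_idem B j : B \in BM -> (j <= D)%N ->
  exists c, B *m E j = c *: E j.
Proof.
move=> BM' jD; apply/vlineP; rewrite idem_basis in BM'.
apply: span_mulmx BM' _ => _ /mapP[i + ->]; rewrite mem_iota => iD.
by rewrite idem_mul//; case: eqP => [->|_]; [exact: memv_line|exact: mem0v].
Qed.

(** The trace is the sum of the squared moduli of the entries. *)
Lemma sum_sqr_norm_eq0 (B : 'M[C]_n) : \tr (B *m (conj_mx B)^T) = 0 -> B = 0.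
Proof.
rewrite /mxtrace => /eqP; rewrite psumr_eq0; last first.
  move=> i _; rewrite mxE sumr_ge0// => j _; rewrite !mxE; exact: mul_conjC_ge0.
move=> /allP B0; apply/matrixP => i j; have := B0 i (mem_index_enum _).
rewrite mxE psumr_eq0 => [|k _]; last by rewrite !mxE mul_conjC_ge0.
move=> /allP/(_ j (mem_index_enum _)); rewrite !mxE mul_conjC_eq0.
by move=> /eqP.
Qed.

Lemma idem_tr j : (j <= D)%N -> (E j)^T = E j.
Proof. by move=> jD; apply/bose_mesner_tr/idem_BM. Qed.

(** Write E' for the conjugate of E_j, so that E' E_j = c E_j. Here [c] is nonzero because the trace
    of E_j E' is a squared norm. Conjugating this relation shows that E' is a multiple of E_j, and
    two nonzero idempotents on one line coincide. *)
Lemma idem_conj j : (j <= D)%N -> conj_mx (E j) = E j.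
Proof.
move=> jD; set E' := conj_mx _.
have EM : E j \in BM by apply: idem_BM.
have E'M : E' \in BM by apply: bose_mesner_conj.
have [c cE] := bose_mesner_idem E'M jD.
have comm : E j *m E' = E' *m E j.
  by apply/esym/bose_mesner_comm => //; rewrite cE memvZ.
have c0 : c != 0.
  apply: contraNneq (idem_neq0 E jD) => c0; apply/eqP/sum_sqr_norm_eq0.
  by rewrite (bose_mesner_tr E'M) comm cE c0 scale0r mxtrace0.
have : c^* *: E' = c *: E j.
  rewrite -cE -comm -map_mxZ -cE map_mxM; congr (_ *m _).
  by rewrite /E'; apply/matrixP => k l; rewrite !mxE /= conjCK.
move=> /(canRL (scalerK _)); rewrite conjC_eq0 => /(_ c0); rewrite scalerA.
set a := _ * c => E'E.
have a0 : a != 0 by rewrite mulf_neq0// invr_eq0 conjC_eq0.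
have : E' *m E' = E' by rewrite -map_mxM idem_mul// eqxx.
rewrite E'E -scalemxAl -scalemxAr scalerA idem_mul// eqxx => /eqP.
rewrite -subr_eq0 -scalerBl scaler_eq0 (negPf (idem_neq0 _ _))// orbF.
by rewrite -{3}[a]mulr1 -mulrBr mulf_eq0 (negPf a0)/= subr_eq0 => /eqP ->; rewrite scale1r.
Qed.

Local Notation As := (dual_assoc_mx E x).

Lemma card_unit_neq0 : (n%:R : C) != 0.
Proof. by rewrite pnatr_eq0 -lt0n; apply/card_gt0P; exists x. Qed.

(* The squared Frobenius norm of [E k *m As *m E l] is
   [#|X| * krein E 1 k l * (E 1) x x]. *)
Lemma krein_dual_assoc_eq0 k l : (k <= D)%N -> (l <= D)%N -> krein E 1 k l = 0 ->
  E k *m As *m E l = 0.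
Proof.
move=> kD lD q0; apply: sum_sqr_norm_eq0.
have As_conj : conj_mx As = As.
  rewrite /dual_assoc_mx map_diag_mx; congr diag_mx; apply/matrixP => i j.
  by rewrite !mxE rmorphM/= conjC_nat -{2}(idem_conj D_gt0) mxE.
pose a := n%:R *: row (enum_rank x) (E 1%N).
have AsE : As = diag_mx a by congr diag_mx; apply/rowP => j; rewrite !mxE.
rewrite !map_mxM/= !idem_conj// As_conj !trmx_mul !idem_tr//.
rewrite AsE tr_diag_mx !mulmxA -(mulmxA _ (E l) (E l)) idem_mul// eqxx.
rewrite mxtrace_mulC !mulmxA idem_mul// eqxx.
have -> : \tr (E k *m diag_mx a *m E l *m diag_mx a) =
    (a *m map2_mx *%R (E k) (E l) *m a^T) 0 0.
  rewrite /mxtrace [RHS]mxE; apply: eq_bigr => i _; rewrite !mul_mx_diag mxE.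
  rewrite [(_ *m E l) i i]mxE [(a *m _) 0 i]mxE [a^T i 0]mxE; congr (_ * _).
  apply: eq_bigr => j _; rewrite mxE [map2_mx _ _ _ _ _]mxE.
  by rewrite -[in LHS](idem_tr kD) [(E k)^T _ _]mxE; ring.
(* Since [a] is a multiple of a row of E_1, it is killed by every E_h with [h != 1]; the term
   [h = 1] carries the coefficient [krein E 1 k l = 0]. *)
suff -> : a *m map2_mx *%R (E k) (E l) = 0 by rewrite mul0mx mxE.
rewrite kreinP// -scalemxAr mulmx_sumr big_mkord big1 ?scaler0// => h _.
rewrite -scalemxAr -scalemxAl -row_mul idem_mul ?leq_ord//.
by case: eqP => [<-|_]; rewrite ?q0 ?scale0r// row0 !scaler0.
Qed.

Hypothesis Qp : Q_polynomial E.

Lemma dual_assoc_tri k l : (k <= D)%N -> (l <= D)%N -> (l.+1 < k)%N ->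
  E k *m As *m E l = 0.
Proof.
move=> kD lD lk; apply: krein_dual_assoc_eq0 => //.
have [+ _] := Qp D_gt0 kD lD; apply.
by apply/or3P; constructor 2; rewrite add1n.
Qed.

(* Q-polynomiality makes every [E j] an entrywise polynomial in [E 1]. *)
Lemma idem1_determines j k l k' l' : (j <= D)%N -> E 1%N k l = E 1%N k' l' ->
  E j k l = E j k' l'.
Proof.
move=> + e1; elim/ltn_ind: j => -[|[|j]] IH jD //; first by rewrite idem0 !mxE.
have jD' := ltnW jD.
have sumE : \sum_(h < D.+1) krein E h 1 j.+1 * E h k l =
            \sum_(h < D.+1) krein E h 1 j.+1 * E h k' l'.
  have /matrixP kr := kreinP E D_gt0 jD'.
  have krE i i' : \sum_(h < D.+1) krein E h 1 j.+1 * E h i i' =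
      n%:R * (E 1%N i i' * E j.+1 i i').
    have := kr i i'; rewrite !mxE => ->; rewrite mulVKf ?card_unit_neq0//.
    by rewrite big_mkord summxE; apply: eq_bigr => h _; rewrite mxE.
  by rewrite !krE e1 IH.
move: sumE; rewrite (bigD1 (Ordinal (jD : (j.+2 < D.+1)%N)))//=.
rewrite [RHS](bigD1 (Ordinal (jD : (j.+2 < D.+1)%N)))//=.
set s := \sum_(_ < _ | _) _; set s' := \sum_(_ < _ | _) _.
(* Terms with [h > j.+2] have zero Krein parameter and those with [h < j.+2] agree by induction,
   leaving E_{j+2} with a nonzero coefficient. *)
have -> : s = s'.
  apply: eq_bigr => h; rewrite -val_eqE/= => hj.
  have [jh|hj'] := ltnP j.+2 h.
    have [+ _] := Qp (leq_ord h) D_gt0 jD'.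
    by rewrite add1n jh => /(_ isT) ->; rewrite !mul0r.
  by congr (_ * _); apply: IH; [rewrite ltn_neqAle hj|rewrite leq_ord].
move=> /addIr; apply: mulfI; apply/eqP.
by have [_] := Qp jD D_gt0 jD'; rewrite add1n eqxx => /(_ isT).
Qed.

Variables (theta thetas : nat -> C).
Hypothesis theta_eigen : forall i, (i <= D)%N -> A 1 *m E i = theta i *: E i.
Hypothesis thetas_eigen : forall i, (i <= D)%N -> As *m S i = thetas i *: S i.

Lemma thetasE i y : (i <= D)%N -> Y i x y ->
  thetas i = n%:R * E 1%N (enum_rank x) (enum_rank y).
Proof.
move=> iD Yi; have /matrixP/(_ (enum_rank y) (enum_rank y)) := thetas_eigen iD.
by rewrite /dual_idem iD mul_diag_mx !mxE eqxx enum_rankK Yi !mulr1 => <-.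
Qed.

(** If theta*_i = theta*_j, then E_1 has equal entries at [(x, y)] and [(x, z)], where [y] and [z]
    are [i]- and [j]-neighbours of [x]. So do all E_h, and hence A_i, which lies in their span; thus
    [z] is also an [i]-neighbour. *)
Lemma thetas_inj i j : (i <= D)%N -> (j <= D)%N -> thetas i = thetas j -> i = j.
Proof.
move=> iD jD.
have [y Yi] := srel_nbr x iD; have [z Yj] := srel_nbr x jD.
rewrite (thetasE iD Yi) (thetasE jD Yj) => /(mulfI card_unit_neq0) e1.
have := assoc_mx_BM iD; rewrite idem_basis => /span_iotaP[c Ac].
have : A i (enum_rank x) (enum_rank y) = A i (enum_rank x) (enum_rank z).
  rewrite Ac !summxE; apply: eq_bigr => h _; rewrite !mxE.
  by congr (_ * _); apply: idem1_determines; rewrite ?leq_ord.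
rewrite !mxE !enum_rankK Yi.
case: (boolP (Y i x z)) => [Yz _|_ /eqP]; last by rewrite oner_eq0.
exact: srel_disjoint Yz Yj.
Qed.

Lemma dual_idem_dual_assoc i : S i *m As = thetas i *: S i.
Proof.
have [Di|iD] := ltnP D i; first by rewrite dual_idem_oob// mul0mx scaler0.
by rewrite -thetas_eigen// /dual_idem iD diag_mxC.
Qed.

Lemma thetas_real i : (i <= D)%N -> thetas i \is Num.real.
Proof.
move=> iD; have [y Yi] := srel_nbr x iD; rewrite (thetasE iD Yi).
apply/CrealP; rewrite rmorphM/= conjC_nat; congr (_ * _).
by rewrite -{2}(idem_conj D_gt0) mxE.
Qed.

Lemma theta_real i : (i <= D)%N -> theta i \is Num.real.
Proof.
move=> iD; apply/CrealP/eqP.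
have := congr1 (map_mx (Num.conj : C -> C)) (theta_eigen iD).
rewrite map_mxM map_mxZ/= assoc_mx_conj idem_conj// theta_eigen// => /eqP.
by rewrite -subr_eq0 -scalerBl scaler_eq0 (negPf (idem_neq0 _ _))// orbF subr_eq0 eq_sym.
Qed.

End Scheme.

(** * Irreducible modules *)

Lemma find_iotaP (P : pred nat) m (r := find P (iota 0 m)) :
  (exists2 i, (i < m)%N & P i) ->
  [/\ (r < m)%N, P r & forall k, (k < r)%N -> P k = false].
Proof.
move=> [i im Pi]; have hP : has P (iota 0 m).
  by apply/hasP; exists i; rewrite ?mem_iota.
have rm : (r < m)%N by rewrite -[X in (_ < X)%N](size_iota 0 m) -has_find.
split=> //; first by have := nth_find 0 hP; rewrite nth_iota.
by move=> k kr; have := before_find 0 kr; rewrite nth_iota// (ltn_trans kr).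
Qed.

Lemma mx_image_neq0 (C : numClosedFieldType) n (M : 'M[C]_n)
    (W : {vspace 'cV[C]_n}) :
  mx_image M W != 0%VS -> exists2 w, w \in W & M *m w != 0.
Proof.
move=> MW; have := vpick0 (mx_image M W); rewrite (negPf MW) => /negbT p0.
have /memv_imgP[w wW e] := memv_pick (mx_image M W).
by exists w; rewrite // -[M *m w](lfunE (mulmx M)) -e.
Qed.

Lemma mem_mx_image (C : numClosedFieldType) n (M : 'M[C]_n)
    (W : {vspace 'cV[C]_n}) w : w \in W -> M *m w \in mx_image M W.
Proof. by move=> wW; rewrite -[M *m w](lfunE (mulmx M)) memv_img. Qed.

Lemma mx_image_eq0 (C : numClosedFieldType) n (M : 'M[C]_n)
    (W : {vspace 'cV[C]_n}) w :
  mx_image M W = 0%VS -> w \in W -> M *m w = 0.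
Proof. by move=> MW /(mem_mx_image M); rewrite MW memv0 => /eqP. Qed.

Lemma card_ord_interval D r e : (r <= e <= D)%N ->
  #|[set i : 'I_D.+1 | (r <= i <= e)%N]| = (e.+1 - r)%N.
Proof.
move=> /andP[re eD]; rewrite -[RHS]muln1 -sum_nat_const_nat.
rewrite big_geq_mkord (big_ord_widen_cond D.+1 (leq r) (fun=> 1%N))// sum1dep_card.
by apply: eq_card => i; rewrite !inE.
Qed.

(** * The matrices R, F, L in terms of components *)

Section Ladder.

Variables (C : numClosedFieldType) (X : finType) (D : nat).
Variables (Y : assoc_scheme X D) (x : X) (v : 'cV[C]_#|X|).

Local Notation A := (assoc_mx C Y 1).
Local Notation S := (fun i : nat => dual_idem C Y x (Posz i)).

(** Multiplication by [S j] selects the term [i = j]; the factor [f] covers E*_{i+1}, E*_i and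
    E*_{i-1} at once. *)
Lemma sum_dual_idem (f : nat -> 'M[C]_#|X|) j :
  (\sum_(0 <= i < D.+1) f i *m A *m S i) *m S j *m v =
  f j *m (A *m (S j *m v)).
Proof.
rewrite !mulmxA; congr (_ *m v); rewrite mulmx_suml.
have [Dj|jD] := ltnP D j.
  by rewrite (dual_idem_oob _ _ _ Dj) mulmx0 big1 // => i _; rewrite mulmx0.
rewrite (bigD1_seq j) ?iota_uniq ?mem_index_iota//= big1 ?addr0 => [|i ij].
  by rewrite -mulmxA dual_idem_mul eqxx.
by rewrite -mulmxA dual_idem_mul (negPf ij) mulmx0.
Qed.

Lemma raising_rpart j : raising C Y x *m S j *m v = rpart A S v j.+1.
Proof.
rewrite (sum_dual_idem (fun i => dual_idem C Y x (i%:Z + 1))) /rpart.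
by rewrite -PoszD addn1.
Qed.

Lemma flat_fpart j : flat C Y x *m S j *m v = fpart A S v j.
Proof. exact: sum_dual_idem. Qed.

Lemma lowering_lpart j : lowering C Y x *m S j.+1 *m v = lpart A S v j.
Proof.
rewrite (sum_dual_idem (fun i => dual_idem C Y x (i%:Z - 1))) /lpart.
by rewrite subzSS subr0.
Qed.

End Ladder.

(** On the line spanned by [v] the scalar [s] qualifies, so [xget] returns a qualifying scalar; it
    equals [s] because [B2 *m v] is nonzero. *)
Lemma module_scalarE (C : numClosedFieldType) (X : finType) (D : nat)
    (Y : assoc_scheme X D) (E : primitive_idempotents C Y)
    (W : {vspace 'cV[C]_#|X|}) (B1 B2 : 'M[C]_#|X|) v s :
  let V := mx_image (E (dual_endpoint E W)) W in
  v \in V -> v != 0 -> (forall w, w \in V -> exists c, w = c *: v) ->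
  B2 *m v != 0 -> B1 *m v = s *: (B2 *m v) -> module_scalar E W B1 B2 = s.
Proof.
move=> V vV v0 Vv B2v B1v; rewrite /module_scalar.
set P := [set s | _]%classic.
have /xgetPex/(_ v vV v0) : exists s, P s.
  exists s => w /Vv[c ->] _.
  by rewrite -!scalemxAr B1v !scalerA mulrC.
move=> /(_ 0); rewrite B1v => /eqP; rewrite eq_sym -subr_eq0 -scalerBl scaler_eq0.
by rewrite (negPf B2v) orbF subr_eq0 => /eqP.
Qed.

(** * The structure of an irreducible T-module *)

Section Module.

Variables (C : numClosedFieldType) (X : finType) (D : nat).
Variables (Y : assoc_scheme X D) (E : primitive_idempotents C Y).
Variables (theta thetas : nat -> C) (x : X) (W : {vspace 'cV[C]_#|X|}).
Hypothesis D_gt0 : (0 < D)%N.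
Hypothesis Pp : P_polynomial Y.
Hypothesis ab : almost_bipartite Y.
Hypothesis Qp : Q_polynomial E.
Hypothesis theta_eigen : forall i, (i <= D)%N ->
  assoc_mx C Y 1 *m E i = theta i *: E i.
Hypothesis thetas_eigen : forall i, (i <= D)%N ->
  dual_assoc_mx E x *m dual_idem C Y x i%:Z = thetas i *: dual_idem C Y x i%:Z.
Hypothesis W_irr : irreducible_T_module Y x W.

Local Notation A := (assoc_mx C Y 1).
Local Notation As := (dual_assoc_mx E x).
Local Notation S := (fun i : nat => dual_idem C Y x (Posz i)).
Local Notation r := (endpoint Y x W).
Local Notation t := (dual_endpoint E W).
Local Notation d := (diameter Y x W).

Lemma module_BM B w : B \in bose_mesner C Y -> w \in W -> B *m w \in W.
Proof. by case: W_irr => WT _ _ BM; apply: WT; constructor. Qed.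

Lemma module_dual_idem i w : w \in W -> S i *m w \in W.
Proof.
have [Di|iD] := ltnP D i; first by rewrite dual_idem_oob// mul0mx mem0v.
case: W_irr => WT _ _; apply: WT; apply: terwilliger_dual.
by apply: memv_span; apply: (map_f (fun i : nat => S i)); rewrite mem_iota.
Qed.

Lemma module_dual_assoc w : w \in W -> As *m w \in W.
Proof.
move=> wW; rewrite -[As *m w]mul1mx -(dual_idem_sum C Y x) mulmx_suml.
apply: memv_suml => i _; rewrite mulmxA (dual_idem_dual_assoc thetas_eigen).
by rewrite -scalemxAl memvZ// module_dual_idem.
Qed.

Lemma module_neq0 : exists2 w, w \in W & w != 0.
Proof.
case: W_irr => _ /eqP W0 _; exists (vpick W); first exact: memv_pick.
by rewrite vpick0.
Qed.

(** The E*_i sum to the identity, so some E*_i does not kill [W] and the search defining [endpoint]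
    succeeds. *)
Lemma endpointP : [/\ (r <= D)%N, exists2 w, w \in W & S r *m w != 0 &
  forall k w, (k < r)%N -> w \in W -> S k *m w = 0].
Proof.
have [|rD Sr Slt] := @find_iotaP (fun i : nat => mx_image (S i) W != 0%VS) D.+1.
  have [w wW w0] := module_neq0; apply: contrapT => noi; case/eqP: w0.
  apply: (S_eq0 (dual_idem_sum C Y x)) => i iD; apply: contrapT => /eqP Siw.
  apply: noi; exists i => //; apply: contraNneq Siw => Si0.
  by apply/eqP; apply: mx_image_eq0 Si0 wW.
split=> //; first exact: mx_image_neq0.
by move=> k w kr; apply: mx_image_eq0; apply/eqP/negbFE/Slt.
Qed.

Lemma dual_endpointP : [/\ (t <= D)%N, mx_image (E t) W != 0%VS &
  forall k w, (k < t)%N -> w \in W -> E k *m w = 0].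
Proof.
have [|tD Et Elt] := @find_iotaP (fun i : nat => mx_image (E i) W != 0%VS) D.+1.
  have [w wW w0] := module_neq0; apply: contrapT => noi; case/eqP: w0.
  rewrite -[w]mul1mx -(idem_sum E) big_mkord mulmx_suml big1// => i _.
  apply: contrapT => /eqP Eiw.
  apply: noi; exists (i : nat) => //; apply: contraNneq Eiw => Ei0.
  by apply/eqP; apply: mx_image_eq0 Ei0 wW.
split=> //.
by move=> k w kt; apply: mx_image_eq0; apply/eqP/negbFE/Elt.
Qed.

Lemma mem_idem_image w : w \in mx_image (E t) W ->
  [/\ w \in W, E t *m w = w & A *m w = theta t *: w].
Proof.
have [tD _ _] := dual_endpointP.
move=> /memv_imgP[u uW ->]; rewrite lfunE/=; split.
- by apply: module_BM => //; apply: idem_BM.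
- by rewrite mulmxA idem_mul// eqxx.
- by rewrite mulmxA theta_eigen// scalemxAl.
Qed.

(** For an eigenvector [v] of E_t A* on E_t W, the part E_k A* v vanishes for [k < t] by the choice
    of [t] and for [k > t.+1] by the Q-polynomial property. So A* v - al v is E_{t+1} A* v, or zero
    when [t = D], and the equation holds whatever [theta D.+1] is. *)
Lemma module_generator : exists v al,
  [/\ v \in mx_image (E t) W, v != 0,
      A *m (As *m v - al *: v) = theta t.+1 *: (As *m v - al *: v) &
      t = D -> As *m v = al *: v].
Proof.
have [tD Et Elt] := dual_endpointP.
have [|al [v [vV v0 alv]]] := stable_eigenvector (B := E t *m As) Et.
  move=> w /mem_idem_image[wW _ _].
  by rewrite -mulmxA; apply/mem_mx_image/module_dual_assoc.
have [vW Ev _] := mem_idem_image vV.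
have AsE : As *m v = al *: v + (if (t < D)%N then E t.+1 *m (As *m v) else 0).
  rewrite -alv -[LHS]mul1mx -(idem_sum E) big_mkord mulmx_suml.
  have zero k : (k <= D)%N -> (k < t)%N || (t.+1 < k)%N -> E k *m (As *m v) = 0.
    move=> kD /orP[kt|tk]; first by rewrite Elt// module_dual_assoc.
    by rewrite -Ev !mulmxA dual_assoc_tri// mul0mx.
  rewrite (bigD1 (Ordinal (tD : (t < D.+1)%N)))//= mulmxA; congr (_ + _).
  case: ifP => tltD.
    rewrite (bigD1 (Ordinal (tltD : (t.+1 < D.+1)%N)))/= -?val_eqE/=; last lia.
    rewrite big1 ?addr0// => k /andP[]; rewrite -!val_eqE/= => kt kt1.
    by apply: zero; [exact: leq_ord|lia].
  rewrite big1// => k; rewrite -val_eqE/= => kt.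
  by have kD := leq_ord k; apply: zero => //; lia.
exists v, al; split=> //; last by move=> tE; rewrite AsE tE ltnn addr0.
rewrite AsE addrAC subrr add0r; case: ifP => tltD; last by rewrite mulmx0 scaler0.
by rewrite mulmxA theta_eigen// scalemxAl.
Qed.

Lemma module_irr (U : {vspace 'cV[C]_#|X|}) : (U <= W)%VS ->
  (forall u, u \in U -> A *m u \in U) ->
  (forall i u, u \in U -> S i *m u \in U) -> U = 0%VS \/ U = W.
Proof.
move=> UW UA US; case: W_irr => _ _; apply=> //.
exact: T_module_of_stable UA US.
Qed.

Lemma diameterE v e : v \in W -> (r <= e <= D)%N ->
  (forall k w, w \in W -> exists c, S k *m w = c *: (S k *m v)) ->
  (forall k, (S k *m v != 0) = (r <= k <= e)%N) -> d = (e - r)%N.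
Proof.
move=> vW re line supp.
rewrite /diameter (_ : #|_| = (e.+1 - r)%N); first lia.
rewrite -(card_ord_interval re); apply: eq_card => i; rewrite !inE -supp.
apply/idP/idP => [/mx_image_neq0[w wW]|].
  by have [c ->] := line i w wW; apply: contraNneq => ->; rewrite scaler0.
by apply: contraNneq => Si0; apply/eqP; apply: mx_image_eq0 Si0 vW.
Qed.

Lemma module_structure : exists v,
  [/\ (r + d <= D)%N /\ ((0 < d)%N -> (t < D)%N),
    [/\ v \in mx_image (E t) W, v != 0 &
        forall w, w \in mx_image (E t) W -> exists c, w = c *: v],
    forall k, (S k *m v != 0) = (r <= k <= r + d)%N,
    (forall i, (i < r + d)%N -> fpart A S v i = 0) /\
    (d = 0%N -> fpart A S v r = theta t *: (S r *m v)) &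
    (0 < d)%N ->
    [/\ lpart A S v r = theta t *: (S r *m v),
      forall i, (r < i < r + d)%N -> rpart A S v i =
        ((theta t * (thetas i.+1 - thetas r.+1)
          - theta t.+1 * (thetas i - thetas r))
         / (thetas i.+1 - thetas i.-1)) *: (S i *m v),
      forall i, (r < i < r + d)%N -> lpart A S v i =
        ((theta t * (thetas i.-1 - thetas r.+1)
          - theta t.+1 * (thetas i - thetas r))
         / (thetas i.-1 - thetas i.+1)) *: (S i *m v),
      rpart A S v (r + d) =
        ((theta t * (thetas (r + d)%N - thetas r.+1)
          - theta t.+1 * (thetas (r + d)%N - thetas r))
         / (thetas (r + d)%N - thetas (r + d).-1)) *: (S (r + d)%N *m v) &
      fpart A S v (r + d) =
        ((theta t * (thetas (r + d).-1 - thetas r.+1)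
          - theta t.+1 * (thetas (r + d)%N - thetas r))
         / (thetas (r + d).-1 - thetas (r + d)%N)) *: (S (r + d)%N *m v)]].
Proof.
have [v [al [vV v0 Av tD]]] := module_generator.
have [vW _ vt] := mem_idem_image vV.
have [rD Sr Slt] := endpointP.
have [e [re line] [supp eig fp fp0 vals]] := tridiagonal_module D_gt0
  (dual_idem_mul C Y x) (@dual_idem_oob C X D Y x) (dual_idem_sum C Y x)
  (@dual_idem_tri C X D Y x D_gt0 Pp)
  (fun i => @dual_idem_flat C X D Y x D_gt0 i ab)
  (dual_idem_dual_assoc thetas_eigen)
  (@thetas_inj C X D Y x D_gt0 Pp E Qp thetas thetas_eigen)
  module_dual_idem module_irr vW v0 vt Av rD Sr Slt.
have dE := diameterE vW re line supp.
have eE : (r + d)%N = e by rewrite dE; lia.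
exists v; rewrite eE; split=> //.
- split=> [|d0]; first lia.
  have [tD' _ _] := dual_endpointP.
  rewrite ltn_neqAle tD' andbT; apply/eqP => tDE.
  (* If [t = D], then [v] is an eigenvector of A*, so theta*_r and theta*_{r+1} would both equal
     [al], against injectivity. *)
  have thE k : (r <= k <= e)%N -> thetas k = al.
    rewrite -supp => Sk; have := congr1 (mulmx (S k)) (tD tDE).
    rewrite mulmxA (dual_idem_dual_assoc thetas_eigen) -scalemxAl -scalemxAr.
    by move=> /eqP; rewrite -subr_eq0 -scalerBl scaler_eq0 (negPf Sk) orbF subr_eq0 => /eqP.
  suff : r = r.+1 by lia.
  by apply: (thetas_inj D_gt0 Pp Qp thetas_eigen); rewrite ?thE//; lia.
- by split=> // w /mem_idem_image[wW _ wt]; apply: eig.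
- by split=> // d0; apply: fp0; lia.
- by move=> d0; apply: vals; lia.
Qed.

(** * Intersection numbers read off from the components of [v] *)

Lemma c_num_first : c_num E x W 0 = 0.
Proof.
have [v [_ [vV v0 Vv] supp _ _]] := module_structure.
apply: (module_scalarE vV v0 Vv); first by rewrite addr0 supp leqnn leq_addr.
(* For [r = 0] the matrix E*_{-1} is zero by convention; otherwise [v] has no component of index
   [r - 1]. *)
rewrite addr0 scale0r; case: r supp => [|m] supp; first by rewrite mulmx0 mul0mx.
rewrite subzSS subr0 -mulmxA; apply/eqP; rewrite (_ : S m *m v = 0) ?mulmx0//.
by apply/eqP/negPn; rewrite supp ltnn.
Qed.

Lemma c_num_rpart v i s : v \in mx_image (E t) W -> v != 0 ->
  (forall w, w \in mx_image (E t) W -> exists c, w = c *: v) ->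
  S (r + i)%N *m v != 0 -> (0 < i)%N ->
  rpart A S v (r + i) = s *: (S (r + i)%N *m v) -> c_num E x W i = s.
Proof.
move=> vV v0 Vv Sv i0 vs; apply: (module_scalarE vV v0 Vv) => //.
case: i i0 vs {Sv} => // i _ vs.
have -> : r%:Z + i.+1%:Z - 1 = Posz (r + i) by rewrite -PoszD addnS subzSS subr0.
by rewrite raising_rpart -addnS vs.
Qed.

Lemma a_num_fpart v i s : v \in mx_image (E t) W -> v != 0 ->
  (forall w, w \in mx_image (E t) W -> exists c, w = c *: v) ->
  S (r + i)%N *m v != 0 ->
  fpart A S v (r + i) = s *: (S (r + i)%N *m v) -> a_num E x W i = s.
Proof.
move=> vV v0 Vv Sv vs; apply: (module_scalarE vV v0 Vv) => //.
by rewrite -PoszD flat_fpart.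
Qed.

Lemma b_num_lpart v i s : v \in mx_image (E t) W -> v != 0 ->
  (forall w, w \in mx_image (E t) W -> exists c, w = c *: v) ->
  S (r + i)%N *m v != 0 ->
  lpart A S v (r + i) = s *: (S (r + i)%N *m v) -> b_num E x W i = s.
Proof.
move=> vV v0 Vv Sv vs; apply: (module_scalarE vV v0 Vv) => //.
have -> : r%:Z + i%:Z + 1 = Posz (r + i).+1 by rewrite -!PoszD addn1.
by rewrite lowering_lpart vs.
Qed.

Lemma b_num_last : b_num E x W d = 0.
Proof.
have [v [_ [vV v0 Vv] supp _ _]] := module_structure.
apply: (b_num_lpart vV v0 Vv); first by rewrite supp leqnn leq_addr.
rewrite scale0r /lpart (_ : S (r + d).+1 *m v = 0) ?mulmx0//.
by apply/eqP/negPn; rewrite supp ltnn andbF.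
Qed.

Lemma a_num_inner i : (i < d)%N -> a_num E x W i = 0.
Proof.
move=> id; have [v [_ [vV v0 Vv] supp [f0 _] _]] := module_structure.
apply: (a_num_fpart vV v0 Vv); first by rewrite supp; lia.
by rewrite f0 ?scale0r// ltn_add2l.
Qed.

Lemma a_num_diam0 : d = 0%N -> a_num E x W 0 = theta t.
Proof.
move=> d0; have [v [_ [vV v0 Vv] supp [_ f0] _]] := module_structure.
apply: (a_num_fpart vV v0 Vv); first by rewrite supp; lia.
by rewrite addn0 f0.
Qed.

Hypothesis d_gt0 : (0 < d)%N.

(** For [d > 0] the index [t.+1] is at most [D], so [theta t.+1] is a genuine eigenvalue. *)
Lemma theta_thetas_real :
  [/\ theta t \is Num.real, theta t.+1 \is Num.real &
      forall i, (i <= r + d)%N -> thetas i \is Num.real].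
Proof.
have [v [[rdD tD] _ _ _ _]] := module_structure.
split; first by apply: (theta_real theta_eigen); apply/ltnW/tD.
  exact/(theta_real theta_eigen)/tD.
by move=> i ird; apply: (thetas_real D_gt0 Pp thetas_eigen); apply: leq_trans rdD.
Qed.

Lemma b_num_first : b_num E x W 0 = theta t.
Proof.
have [v [_ [vV v0 Vv] supp _ /(_ d_gt0)[l0 _ _ _ _]]] := module_structure.
apply: (b_num_lpart vV v0 Vv); first by rewrite supp; lia.
by rewrite addn0 l0.
Qed.

Lemma c_num_inner i : (0 < i < d)%N -> c_num E x W i =
  (theta t * (thetas (r + i).+1 - thetas r.+1)
   - theta t.+1 * (thetas (r + i)%N - thetas r))
  / (thetas (r + i).+1 - thetas (r + i).-1).
Proof.
move=> /andP[i0 id].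
have [v [_ [vV v0 Vv] supp _ /(_ d_gt0)[_ ri _ _ _]]] := module_structure.
by apply: (c_num_rpart vV v0 Vv) => //; [rewrite supp|apply: ri]; lia.
Qed.

Lemma b_num_inner i : (0 < i < d)%N -> b_num E x W i =
  (theta t * (thetas (r + i).-1 - thetas r.+1)
   - theta t.+1 * (thetas (r + i)%N - thetas r))
  / (thetas (r + i).-1 - thetas (r + i).+1).
Proof.
move=> /andP[i0 id].
have [v [_ [vV v0 Vv] supp _ /(_ d_gt0)[_ _ li _ _]]] := module_structure.
by apply: (b_num_lpart vV v0 Vv) => //; [rewrite supp|apply: li]; lia.
Qed.

Lemma c_num_last : c_num E x W d =
  (theta t * (thetas (r + d)%N - thetas r.+1)
   - theta t.+1 * (thetas (r + d)%N - thetas r))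
  / (thetas (r + d)%N - thetas (r + d).-1).
Proof.
have [v [_ [vV v0 Vv] supp _ /(_ d_gt0)[_ _ _ rd _]]] := module_structure.
by apply: (c_num_rpart vV v0 Vv) => //; rewrite supp; lia.
Qed.

Lemma a_num_last : a_num E x W d =
  (theta t * (thetas (r + d).-1 - thetas r.+1)
   - theta t.+1 * (thetas (r + d)%N - thetas r))
  / (thetas (r + d).-1 - thetas (r + d)%N).
Proof.
have [v [_ [vV v0 Vv] supp _ /(_ d_gt0)[_ _ _ _ fd]]] := module_structure.
by apply: (a_num_fpart vV v0 Vv) => //; rewrite supp; lia.
Qed.

End Module.

Theorem theorem11p4 (K : realType) (X : finType) (D : nat)
  (Y : assoc_scheme X D) (E : primitive_idempotents K[i] Y)
  (theta thetas : nat -> K[i]) (x : X) (W : {vspace 'cV[K[i]]_#|X|})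
  (r t d : nat)
  (hD : (3 <= D)%N)
  (hP : P_polynomial Y)
  (hAB : almost_bipartite Y)
  (hQ : Q_polynomial E)
  (htheta : forall i, (i <= D)%N -> assoc_mx K[i] Y 1 *m E i = theta i *: E i)
  (hthetas : forall i, (i <= D)%N ->
     dual_assoc_mx E x *m dual_idem K[i] Y x i%:Z
     = thetas i *: dual_idem K[i] Y x i%:Z)
  (hW : irreducible_T_module Y x W)
  (hr : r = endpoint Y x W)
  (ht : t = dual_endpoint E W)
  (hd : d = diameter Y x W) :
  (d = 0%N ->
     [/\ c_num E x W 0 = 0, a_num E x W 0 = theta t & b_num E x W 0 = 0])
  /\
  ((1 <= d)%N ->
     [/\ c_num E x W 0 = 0,
         forall i, (1 <= i <= d - 1)%N ->
           c_num E x W i =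
           (theta t * (thetas (r + i + 1)%N - thetas (r + 1)%N)
            - theta (t + 1)%N * (thetas (r + i)%N - thetas r))
           / (thetas (r + i + 1)%N - thetas (r + i - 1)%N)
       & c_num E x W d =
         (theta t * (thetas (r + d)%N - thetas (r + 1)%N)
          - theta (t + 1)%N * (thetas (r + d)%N - thetas r))
         / (thetas (r + d)%N - thetas (r + d - 1)%N)]
     /\
     [/\ forall i, (i <= d - 1)%N -> a_num E x W i = 0
       & a_num E x W d =
         (theta t * (thetas (r + d - 1)%N - thetas (r + 1)%N)
          - theta (t + 1)%N * (thetas (r + d)%N - thetas r))
         / (thetas (r + d - 1)%N - thetas (r + d)%N)]
     /\
     [/\ b_num E x W 0 = theta t,
         forall i, (1 <= i <= d - 1)%N ->
           b_num E x W i =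
           (theta t * (thetas (r + i - 1)%N - thetas (r + 1)%N)
            - theta (t + 1)%N * (thetas (r + i)%N - thetas r))
           / (thetas (r + i - 1)%N - thetas (r + i + 1)%N)
       & b_num E x W d = 0])
  /\
  (forall i, (i <= d)%N ->
     [/\ c_num E x W i \is Num.real, a_num E x W i \is Num.real
       & b_num E x W i \is Num.real]).
Proof.
have D0 : (0 < D)%N by lia.
have c0 := c_num_first D0 hP hAB hQ htheta hthetas hW.
have bd := b_num_last D0 hP hAB hQ htheta hthetas hW.
have ai := a_num_inner D0 hP hAB hQ htheta hthetas hW.
have ad0 := a_num_diam0 D0 hP hAB hQ htheta hthetas hW.
have b0 := b_num_first D0 hP hAB hQ htheta hthetas hW.
have ci := c_num_inner D0 hP hAB hQ htheta hthetas hW.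
have bi := b_num_inner D0 hP hAB hQ htheta hthetas hW.
have cd := c_num_last D0 hP hAB hQ htheta hthetas hW.
have ad := a_num_last D0 hP hAB hQ htheta hthetas hW.
have re := theta_thetas_real D0 hP hAB hQ htheta hthetas hW.
have [tD _ _] := dual_endpointP E hW.
have tr := theta_real htheta tD.
rewrite -hr -ht -hd in bd ai ad0 b0 ci bi cd ad re tD tr.
rewrite !addn1; split; [|split].
- by move=> d0; split; [exact: c0|exact: ad0|move: bd; rewrite d0].
- move=> d1; split; [|split]; split; rewrite ?subn1.
  + exact: c0.
  + by move=> i /andP[i0 id]; rewrite ci; [rewrite addn1 subn1|exact: d1|lia].
  + exact: cd.
  + by move=> i id; apply: ai; lia.
  + exact: ad.
  + exact: b0.
  + by move=> i /andP[i0 id]; rewrite bi; [rewrite addn1 subn1|exact: d1|lia].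
  + exact: bd.
have [d0 i|d0 i id] := posnP d.
  by rewrite d0 in bd *; rewrite leqn0 => /eqP ->; rewrite c0 ad0 ?bd ?real0 ?tr.
have [_ tr' sr] := re d0.
(* Every fraction in the formulas has this shape, with theta* indices at most [r + d]. *)
have quot p q k l m : (k <= r + d)%N -> (l <= r + d)%N -> (m <= r + d)%N ->
    (p <= r + d)%N -> (q <= r + d)%N ->
    (theta t * (thetas k - thetas l) - theta t.+1 * (thetas m - thetas r))
    / (thetas p - thetas q) \is Num.real.
  move=> kd ld md pd qd; have rd := leq_addr d r.
  by rewrite realM ?realV ?realB ?realM ?realB ?sr.
have [di|id'] := leqP d i.
  have -> : i = d by lia.
  by rewrite bd real0 (cd d0) (ad d0); split=> //; apply: quot; lia.
rewrite (ai _ id') real0; have [->|i0] := posnP i; first by rewrite c0 (b0 d0) real0.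
have i0d : (0 < i < d)%N by rewrite i0.
by rewrite (ci d0 _ i0d) (bi d0 _ i0d); split=> //; apply: quot; lia.
Qed.
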